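(* If $\delta\in\Delta_{min}$ then $\mathcal{G}^{\delta}$ is a minimal hereditary class of both unbounded linear clique-width and unbounded clique-width.
   Context: $\mathbb{N}=\{1,2,\dots\}$; all graphs are simple and undirected; $[a,b]=\{a,a+1,\dots,b\}$. A bond-set $\beta$ is a symmetric subset of $\{(x,y)\in\mathbb{N}^2: |x-y|>1\}$. A $\delta$-triple $\delta=(\alpha,\beta,\gamma)$ consists of an infinite word $\alpha=\alpha_1\alpha_2\cdots$ over the alphabet $\{0,1,2,3\}$, a bond-set $\beta$, and an infinite binary word $\gamma=\gamma_1\gamma_2\cdots$. The infinite graph $\mathcal{P}^{\delta}$ has vertex set $\{v_{i,j}: i,j\in\mathbb{N}\}$, where $v_{i,j}$ is in column $i$ and row $j$; $C_i=\{v_{i,j}:j\in\mathbb{N}\}$. Its edges are the following. (a) Between $C_i$ and $C_{i+1}$, for each $i\ge 1$: $v_{i,j}\sim v_{i+1,k}$ iff $j=k$ when $\alpha_i=0$; iff $j\ne k$ when $\alpha_i=1$; iff $j\ge k$ when $\alpha_i=2$; iff $j<k$ when $\alpha_i=3$. (b) Between $C_i$ and $C_j$ with $|i-j|>1$: all edges if $(i,j)\in\beta$, and none otherwise. (c) Within $C_i$: all edges if $\gamma_i=1$ (a clique), none if $\gamma_i=0$ (an independent set). $\mathcal{G}^{\delta}$ is the class of all finite induced subgraphs of $\mathcal{P}^{\delta}$. For a graph $G=(V,E)$ and $U\subseteq V$, two vertices of $U$ are $V\setminus U$-similar if they have the same neighbourhood in $V\setminus U$; $\mu(G,U)$ is the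 number of equivalence classes of this relation on $U$. For finite $Q\subseteq\mathbb{N}$ let $R_1(Q)=\{v_{i,1}:i\in Q\}$ and $R_2(Q)=\{v_{i,2}:i\in Q\}$, let $T^{\delta}(Q)$ be the subgraph of $\mathcal{P}^{\delta}$ induced on $R_1(Q)\cup R_2(Q)$, and let $\mathcal{N}^{\delta}(Q)=\mu(T^{\delta}(Q),R_1(Q))$. The bond-graph $B^{\beta}(Q)$ has vertex set $Q$ and edges the pairs $(x,y)\in\beta$ with $x,y\in Q$. For $n\ge2$ let $\mathcal{M}^{\beta}(n)=\sup_{m<n}\mu(B^{\beta}([1,n]),[1,m])$. The bond-set $\beta$ has bounded $\mathcal{M}^{\beta}$ if there is $M$ with $\mathcal{M}^{\beta}(n)<M$ for all $n$. For $k\ge2$ the $k$-factor $\delta_{[j,j+k-1]}$ is the triple $(\alpha_{[j,j+k-2]};\beta_{[j,j+k-1]};\gamma_{[j,j+k-1]})$, where $\alpha_{[a,b]}$, $\gamma_{[a,b]}$ denote the subwords from position $a$ to $b$ and $\beta_{[a,b]}=\{(x,y)\in\beta: a\le x,y\le b\}$. Two $k$-factors $\delta_{[x,x+k-1]}$ and $\delta_{[y,y+k-1]}$ are the same if $\alpha_{x+i}=\alpha_{y+i}$ for $0\le i\le k-2$, $\gamma_{x+i}=\gamma_{y+i}$ for $0\le i\le k-1$, and $(x+i,x+i')\in\beta\iff(y+i,y+i')\in\beta$ for $0\le i,i'\le k-1$. $\delta$ is recurrent if every $k$-factor occurs in it infinitely many times. For a $k$-factor $\delta^*$, a $\delta^*$-gap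 factor is a factor $\delta_Q$ of $\delta$ between, and including, some consecutive disjoint pair of occurrences of $\delta^*$ (that is, $Q=[a,b+k-1]$ with $\delta^*$ occurring at $[a,a+k-1]$ and at $[b,b+k-1]$, $b\ge a+k$, and no occurrence of $\delta^*$ starting in $[a+k,b-1]$). $\delta$ is $\mathcal{N}^{\delta}$-bounded recurrent if it is recurrent and, for any factor $\delta^*$ and any $\delta^*$-gap factor $\delta_Q$, the value $\mathcal{N}^{\delta}(Q)$ is bounded by a function of $\delta^*$ only (irrespective of the gap factor chosen). The clique-width of a graph $G$ is the minimum number of labels needed to construct $G$ using: creation of a vertex with a label $i$; adding all edges between vertices labelled $i$ and vertices labelled $j$ ($i\ne j$); relabelling all vertices labelled $i$ to $j$; and disjoint union of two previously constructed labelled graphs. The linear clique-width is defined in the same way except that in each disjoint union one of the two graphs must be a single labelled vertex (or empty). $\Delta$ is the set of all $\delta$-triples for which $\mathcal{G}^{\delta}$ has unbounded clique-width. $\Delta_{min}\subseteq\Delta$ is the set of all $\delta\in\Delta$ such that (a) $\delta$ is $\mathcal{N}^{\delta}$-bounded recurrent, and (b) $\beta$ has bounded $\mathcal{M}^{\beta}$. A class of graphs is hereditary if closed under taking induced subgraphs. A hereditary class is minimal of unbounded (linear) clique-width if it has unbounded (linear) clique-width and every proper hereditary subclass has bounded (linear) clique-width. *)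

(* Defs.v *)
From HB Require Import structures.
From mathcomp Require Import all_boot.
From mathcomp Require Import finmap.

Set Implicit Arguments.
Unset Strict Implicit.
Unset Printing Implicit Defensive.

Record graph := Graph {
  gvertex :> choiceType;
  gadj : rel gvertex;
  gadj_sym : symmetric gadj;
  gadj_irr : irreflexive gadj }.

Record sgraph := SGraph {
  vertex :> finType;
  adj : rel vertex;
  adj_sym : symmetric adj;
  adj_irr : irreflexive adj }.

Definition induced_in (T U : Type) (e : rel T) (r : rel U) : Prop :=
  exists2 f : T -> U, injective f & {mono f : x y / e x y >-> r x y}.

Definition isomorphic (G H : sgraph) : Prop :=
  exists2 f : G -> H, bijective f & {mono f : x y / adj x y >-> adj x y}.

Section Induced.
Variables (G : graph) (S : {fset G}).
Definition induced_adj : rel S := fun x y => gadj (val x) (val y).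
Fact induced_sym : symmetric induced_adj.
Proof. by move=> x y; apply: gadj_sym. Qed.
Fact induced_irr : irreflexive induced_adj.
Proof. by move=> x; apply: gadj_irr. Qed.
Definition induced : sgraph := SGraph induced_sym induced_irr.
End Induced.

Definition graph_class := sgraph -> Prop.

Definition hereditary (C : graph_class) : Prop :=
  forall G H : sgraph, C G -> induced_in (@adj H) (@adj G) -> C H.

Definition proper_subclass (D C : graph_class) : Prop :=
  (forall G, D G -> C G) /\ (exists2 G, C G & ~ D G).

Definition similar (G : sgraph) (U : {set G}) : rel G :=
  fun x y => [forall z in ~: U, adj x z == adj y z].

Definition mu (G : sgraph) (U : {set G}) : nat :=
  #|equivalence_partition (similar U) U|.

(* Clique-width.  The empty graph is allowed as a starting point, so that the
   empty graph has (linear) clique-width 0; nonempty graphs are unaffected. *)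

Inductive cwexpr (k : nat) : Type :=
  | cw_empty
  | cw_vertex of 'I_k
  | cw_join (i j : 'I_k) of i != j & cwexpr k
  | cw_relabel of 'I_k & 'I_k & cwexpr k
  | cw_union of cwexpr k & cwexpr k.
Arguments cw_empty {k}.

Record lgraph (k : nat) := LGraph {
  lg_graph :> sgraph;
  label : lg_graph -> 'I_k }.

Section EdgelessGraph.
Variable T : finType.
Definition edgeless_adj : rel T := fun _ _ => false.
Fact edgeless_sym : symmetric edgeless_adj. Proof. by []. Qed.
Fact edgeless_irr : irreflexive edgeless_adj. Proof. by []. Qed.
Definition edgeless : sgraph := SGraph edgeless_sym edgeless_irr.
End EdgelessGraph.

Section JoinGraph.
Variables (k : nat) (G : lgraph k) (i j : 'I_k) (neq_ij : i != j).
Definition join_adj : rel G := fun x y =>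
  [|| adj x y, (label x == i) && (label y == j)
    | (label x == j) && (label y == i)].
Fact join_sym : symmetric join_adj.
Proof.
move=> x y; rewrite /join_adj adj_sym; congr orb; rewrite orbC.
by congr orb; exact: andbC.
Qed.
Fact join_irr : irreflexive join_adj.
Proof.
move=> x; rewrite /join_adj adj_irr /= [X in _ || X]andbC orbb.
by apply/negP => /andP[/eqP-> eq_ij]; move: neq_ij; rewrite eq_ij.
Qed.
Definition join_graph : sgraph := SGraph join_sym join_irr.
End JoinGraph.

Section UnionGraph.
Variables G H : sgraph.
Definition union_adj : rel (G + H) := fun u v =>
  match u, v with
  | inl x, inl y => adj x y
  | inr x, inr y => adj x y
  | _, _ => false
  end.
Fact union_sym : symmetric union_adj.
Proof. by move=> [x|x] [y|y] //=; apply: adj_sym. Qed.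
Fact union_irr : irreflexive union_adj.
Proof. by move=> [x|x] /=; apply: adj_irr. Qed.
Definition union_graph : sgraph := SGraph union_sym union_irr.
End UnionGraph.

Fixpoint cw_eval (k : nat) (t : cwexpr k) : lgraph k :=
  match t with
  | cw_empty => @LGraph k (edgeless void) (fun x : void => match x with end)
  | cw_vertex i => @LGraph k (edgeless unit) (fun=> i)
  | cw_join i j neq_ij t1 =>
      @LGraph k (join_graph (cw_eval t1) neq_ij) (@label k (cw_eval t1))
  | cw_relabel i j t1 =>
      @LGraph k (cw_eval t1)
        (fun x => if label x == i then j else label x)
  | cw_union t1 t2 =>
      @LGraph k (union_graph (cw_eval t1) (cw_eval t2))
        (fun u => match u with inl x => label x | inr x => label x end)
  end.

Fixpoint cw_linear (k : nat) (t : cwexpr k) : bool :=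
  match t with
  | cw_empty | cw_vertex _ => true
  | cw_join _ _ _ t1 | cw_relabel _ _ t1 => cw_linear t1
  | cw_union t1 t2 =>
      [&& cw_linear t1, cw_linear t2
        & (#|cw_eval t1| <= 1) || (#|cw_eval t2| <= 1)]
  end.

Definition cw_constructible (G : sgraph) (k : nat) : Prop :=
  exists t : cwexpr k, isomorphic G (cw_eval t).

Definition lcw_constructible (G : sgraph) (k : nat) : Prop :=
  exists2 t : cwexpr k, cw_linear t & isomorphic G (cw_eval t).

Definition is_minimum (P : nat -> Prop) (k : nat) : Prop :=
  P k /\ forall j, P j -> k <= j.

Definition has_cliquewidth (G : sgraph) (k : nat) : Prop :=
  is_minimum (cw_constructible G) k.

Definition has_linear_cliquewidth (G : sgraph) (k : nat) : Prop :=
  is_minimum (lcw_constructible G) k.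

(* A width parameter is given by its graph: [w G k] means that G has width k. *)

Definition bounded_width (w : sgraph -> nat -> Prop) (C : graph_class) : Prop :=
  exists N, forall G, C G -> exists2 k, w G k & k <= N.

Definition unbounded_width (w : sgraph -> nat -> Prop) (C : graph_class) :=
  ~ bounded_width w C.

Definition minimal_unbounded (w : sgraph -> nat -> Prop) (C : graph_class) :=
  [/\ hereditary C, unbounded_width w C
    & forall D : graph_class,
        hereditary D -> proper_subclass D C -> bounded_width w D].

(* All indices (columns, rows, letters of words, elements of bond-sets) are
   counted from 0 instead of 1: the index i below stands for i + 1. *)

Record bond_set := BondSet {
  bond :> rel nat;
  bond_sym : symmetric bond;
  bond_far : forall x y, bond x y -> (x.+1 < y) || (y.+1 < x) }.

Record delta_triple := DeltaTriple {
  alpha : nat -> 'I_4;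
  beta : bond_set;
  gamma : nat -> bool }.

Definition letter_adj (a : 'I_4) (j k : nat) : bool :=
  match val a with
  | 0 => j == k
  | 1 => j != k
  | 2 => j >= k
  | _ => j < k
  end.

Section Pgraph.
Variable d : delta_triple.
(* The vertex in column i and row j is the pair (i, j). *)
Definition P_adj : rel (nat * nat) := fun u v =>
  if u.1 == v.1 then gamma d u.1 && (u.2 != v.2)
  else if v.1 == u.1.+1 then letter_adj (alpha d u.1) u.2 v.2
  else if u.1 == v.1.+1 then letter_adj (alpha d v.1) v.2 u.2
  else beta d u.1 v.1.
Fact P_sym : symmetric P_adj.
Proof.
move=> [i j] [i' k]; rewrite /P_adj /= [i' == i]eq_sym.
case: eqP => [->|_]; first by rewrite eq_sym.
case: (i' =P i.+1) => [->|_].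
  by rewrite ifF //; apply/eqP => /eqP; rewrite -addn2 -{1}[i]addn0 eqn_add2l.
by case: (i =P i'.+1) => // _; apply: bond_sym.
Qed.
Fact P_irr : irreflexive P_adj.
Proof. by move=> [i j]; rewrite /P_adj /= !eqxx andbF. Qed.
Definition Pgraph : graph := @Graph (nat * nat)%type P_adj P_sym P_irr.
End Pgraph.

Definition Gclass (d : delta_triple) : graph_class :=
  fun G => induced_in (@adj G) (@gadj (Pgraph d)).

Definition vrow (j : nat) (Q : {fset nat}) : {fset nat * nat} :=
  [fset (i, j) | i in Q]%fset.

Definition Tgraph (d : delta_triple) (Q : {fset nat}) : sgraph :=
  @induced (Pgraph d) (vrow 0 Q `|` vrow 1 Q)%fset.

Definition Nparam (d : delta_triple) (Q : {fset nat}) : nat :=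
  @mu (Tgraph d Q) [set u : Tgraph d Q | val u \in vrow 0 Q].

Section BondGraph.
Variable b : bond_set.
Fact bond_irr : irreflexive b.
Proof.
by move=> x; apply/negP => /bond_far; rewrite orbb ltnNge leqnSn.
Qed.
Definition full_bond_graph : graph := @Graph nat b (@bond_sym b) bond_irr.
Definition bond_graph (Q : {fset nat}) : sgraph := @induced full_bond_graph Q.
End BondGraph.

(* n is the number of elements, not the right endpoint. *)
Definition segment (a n : nat) : {fset nat} := [fset i in iota a n]%fset.

Definition Mparam (b : bond_set) (n : nat) : nat :=
  \max_(1 <= m < n)
    @mu (bond_graph b (segment 0 n))
        [set u : bond_graph b (segment 0 n) | val u \in segment 0 m].

Definition bounded_M (b : bond_set) : Prop :=
  exists M, forall n, 2 <= n -> Mparam b n < M.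

Definition same_factor (d : delta_triple) (k x y : nat) : Prop :=
  [/\ forall i, i.+1 < k -> alpha d (x + i) = alpha d (y + i),
      forall i, i < k -> gamma d (x + i) = gamma d (y + i)
    & forall i i', i < k -> i' < k ->
        beta d (x + i) (x + i') = beta d (y + i) (y + i')].

Definition recurrent (d : delta_triple) : Prop :=
  forall k x, 2 <= k -> forall n, exists2 y, n <= y & same_factor d k x y.

(* With delta* the k-factor of d starting at x, the factor of d on the
   columns a, ..., b + k - 1 is a delta*-gap factor. *)
Definition gap_factor (d : delta_triple) (k x a b : nat) : Prop :=
  [/\ same_factor d k x a, same_factor d k x b, a + k <= b
    & forall c, a + k <= c < b -> ~ same_factor d k x c].

Definition N_bounded_recurrent (d : delta_triple) : Prop :=
  recurrent d /\
  forall k x, 2 <= k -> exists N, forall a b,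
    gap_factor d k x a b -> Nparam d (segment a (b + k - a)) <= N.

Definition in_Delta (d : delta_triple) : Prop :=
  unbounded_width has_cliquewidth (Gclass d).

Definition in_Delta_min (d : delta_triple) : Prop :=
  [/\ in_Delta d, N_bounded_recurrent d & bounded_M (beta d)].

(* Main.v *)
Require Import Defs.
From mathcomp Require Import all_boot.
From mathcomp Require Import finmap boolp zify.

(** Unboundedness is part of the hypothesis (linear clique-width is at least
clique-width), so the point is minimality: if [D] is hereditary, contained in
the class of [d], and misses some graph [F] of it, then the graphs of [D] have
bounded linear clique-width, hence bounded clique-width.

It suffices to order the vertices of each [G] in [D] so that every initial
segment has boundedly many neighbourhood types towards the remaining vertices
([lcw_of_layout]); boundedness of such types is recorded throughout by a
function ([coherent] key) into a fixed finite type.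

Embed [F] into the first [m.+1] columns and the first [n] rows, and let the
factor on these columns recur at columns [a 0 = 0], [a 1], [a 2], and so on,
the occurrences being consecutive and disjoint.  Fix an embedding of [G]
in the infinite graph.  At an occurrence, consider
left-to-right crossings: one vertex of [G] per column, consecutive rows being
equal under the letters 0 and 1, and weakly decreasing under 2 and 3.  A stack
of [n] crossings, each entirely above the previous one, induces exactly the
[m.+1] by [n] corner of the infinite graph ([stack_P_adj]), hence contains [F]
([stack_induced]).  So [G] has no such stack, and cutting greedily from the
bottom splits the rows into at most [2 n] intervals, each either a single row
or free of crossings ([strip_partition]).  In an interval without crossings,
the vertices reachable from the left can be completed to a left side whose
adjacencies with the right side, inside the interval, depend on the pair of
columns only ([strip_cut]).  Gluing the left sides over all intervals yields a
cut of [G] through the occurrence, whose left part has boundedly many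
neighbourhood types: one per column and interval inside the occurrence, and
boundedly many before it by the bound on the bond-graphs ([vertical_cut]).

These cuts divide [G] into chunks, each of which lives on the columns of one
gap factor.  List the chunks from left to right, and each chunk row by row
([layout_lcw]).  In the current chunk, completed rows see later vertices
through the two-row graph of the gap factor, which has boundedly many types;
the current row sees its own remainder through bonds only, except for
the last listed column, which may see the next one.  *)

Set Implicit Arguments.
Unset Strict Implicit.
Unset Printing Implicit Defensive.

(** * Linear clique-width from vertex orderings *)

(** A bound on the number of similarity classes of [p] towards its complement,
in the form of a function that refines them: both the labellings of
expressions and the bounds on [mu] take this form. *)
Definition coherent (V T : Type) (e : rel V) (p : pred V) (key : V -> T) :=
  forall x y, p x -> p y -> key x = key y ->
  forall z, ~~ p z -> e x z = e y z.

Section Realize.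
Variables (G : sgraph) (k : nat).

(** Evaluating an expression builds a new vertex type at every union, so its
value is compared with a part of a fixed graph [G] through an embedding [g].
The relation [e] varies, since a newly added vertex is joined to its
neighbours one label at a time. *)
Definition realizes (t : cwexpr k) (p : pred G) (e : rel G)
    (lab : G -> 'I_k) : Prop :=
  exists g : cw_eval t -> G,
    [/\ injective g, forall x, p x <-> exists y, g y = x,
        {mono g : x y / adj x y >-> e x y}
      & forall y, label y = lab (g y)].

Lemma eq_realizes t p e lab p' e' lab' :
  realizes t p e lab -> p =1 p' ->
  (forall x y, p x -> p y -> e x y = e' x y) ->
  (forall x, p x -> lab x = lab' x) -> realizes t p' e' lab'.
Proof.
case=> g [g_inj g_im g_e g_lab] eq_p eq_e eq_lab.
have pg y : p (g y) by apply/g_im; exists y.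
exists g; split=> // [x | x y | y]; first by rewrite -eq_p; apply: g_im.
  by rewrite -eq_e ?g_e.
by rewrite -eq_lab ?g_lab.
Qed.

Lemma realizes_add_vertex t p e lab v l :
  ~~ p v -> realizes t p e lab ->
  realizes (cw_union t (cw_vertex l)) (predU1 v p)
    (fun x y => [&& e x y, x != v & y != v])
    (fun x => if x == v then l else lab x).
Proof.
move=> pv [g [g_inj g_im g_e g_lab]].
have gv y : (g y == v) = false.
  by apply: contraNF pv => /eqP <-; apply/g_im; exists y.
exists (fun u => match u with inl y => g y | inr _ => v end); split.
- move=> [x|[]] [y|[]] //=; first by move/g_inj->.
    by move/eqP; rewrite gv.
  by move/esym/eqP; rewrite gv.
- move=> x; rewrite /= ; split.
    by case: eqP => [-> _|_ /= /g_im[y <-]]; [exists (inr tt)|exists (inl y)].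
  case=> [[y|[]]] <-; last by rewrite eqxx.
  by apply/orP; right; apply/g_im; exists y.
- by move=> [x|[]] [y|[]] /=; rewrite ?eqxx ?andbF ?gv //= ?andbT ?g_e.
- by case=> [y|[]] /=; rewrite ?eqxx ?gv ?g_lab.
Qed.

Lemma realizes_joins t p e lab l0 (ls : seq 'I_k) :
  cw_linear t -> realizes t p e lab -> l0 \notin ls ->
  exists2 t', cw_linear t' & realizes t' p
    (fun x y => [|| e x y, (lab x == l0) && (lab y \in ls)
                  | (lab x \in ls) && (lab y == l0)]) lab.
Proof.
move=> t_lin t_real; elim: ls => [|l ls IHls].
  exists t => //; apply: eq_realizes t_real _ _ _ => // x y _ _.
  by rewrite !in_nil andbF !orbF.
rewrite inE negb_or => /andP[neq_l /IHls[t' t'_lin [g [g_inj g_im g_e g_lab]]]].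
exists (cw_join neq_l t') => //; exists g; split=> // x y.
rewrite /= /join_adj -g_e !g_lab !inE.
by case: (e _ _); case: (lab (g x) == l0); case: (lab (g y) == l0);
   case: (lab (g x) == l); case: (lab (g y) == l);
   case: (_ \in ls); case: (_ \in ls).
Qed.

Lemma realizes_merge t p e lab l1 l2 :
  realizes t p e lab ->
  realizes (cw_relabel l1 l2 t) p e
    (fun x => if lab x == l1 then l2 else lab x).
Proof. by case=> g [? ? ? g_lab]; exists g; split=> //= y; rewrite g_lab. Qed.

(** If all the labels are used, choose a vertex for each of them: there are
fewer keys than labels, so two of these vertices have equal keys, hence are
similar, and merging their labels keeps the labelling coherent. *)
Lemma free_label (T : finType) (key : G -> T) t p lab :
  #|T| < k -> cw_linear t -> realizes t p (@adj G) lab ->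
  coherent (@adj G) p lab -> coherent (@adj G) p key ->
  exists t' lab' l0,
    [/\ cw_linear t', realizes t' p (@adj G) lab', coherent (@adj G) p lab'
      & forall x, p x -> lab' x != l0].
Proof.
move=> ltTk t_lin t_real t_coh key_coh.
have [[l0 free]|used] := pselect (exists l0, forall x, p x -> lab x != l0).
  by exists t, lab, l0.
have rep l : {x | p x /\ lab x = l}.
  apply: cid; apply: contrapT => nx; apply: used; exists l => x px.
  by apply/eqP => labx; apply: nx; exists x.
have [key_inj|] := boolP (injectiveb (fun l => key (sval (rep l)))).
  by have := leq_card _ (injectiveP _ key_inj); rewrite card_ord leqNgt ltTk.
case/injectivePn => l1 [l2 neq_l eq_key].
exists (cw_relabel l1 l2 t), (fun x => if lab x == l1 then l2 else lab x), l1.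
have [p1 lab1] := svalP (rep l1); have [p2 lab2] := svalP (rep l2).
have merge z x : ~~ p z -> p x ->
    adj x z = adj (sval (rep (if lab x == l1 then l2 else lab x))) z.
  move=> pz px; case: eqP => [labx|_].
    rewrite -(key_coh _ _ p1 p2 eq_key z pz).
    by apply: t_coh => //; rewrite lab1.
  by have [px' labx'] := svalP (rep (lab x)); apply: t_coh.
split=> //; first exact: realizes_merge.
  by move=> x y px py eq_l z pz; rewrite (merge z x) // (merge z y) // eq_l.
by move=> x px; case: (eqVneq (lab x) l1) => // _; rewrite eq_sym.
Qed.

(** A vertex carrying a fresh label can be joined to exactly its neighbours:
by coherence, these form a union of label classes. *)
Lemma realizes_extend t p lab v l0 :
  cw_linear t -> realizes t p (@adj G) lab -> coherent (@adj G) p lab ->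
  (forall x, p x -> lab x != l0) -> ~~ p v ->
  exists t' lab',
    [/\ cw_linear t', realizes t' (predU1 v p) (@adj G) lab'
      & coherent (@adj G) (predU1 v p) lab'].
Proof.
move=> t_lin t_real t_coh free pv.
pose lab' x := if x == v then l0 else lab x.
pose ls := [seq l <- enum 'I_k | (l != l0) &&
                                 [exists x, [&& p x, lab x == l & adj x v]]].
have ls_l0 : l0 \notin ls by rewrite mem_filter eqxx.
have lab'p x : p x -> lab' x = lab x.
  by move=> px; rewrite /lab'; case: eqP pv => // <-; rewrite px.
have adj_ls x : p x -> (lab x \in ls) = adj x v.
  move=> px; rewrite mem_filter mem_enum andbT free //=.
  apply/existsP/idP => [[y /and3P[py /eqP lab_y yv]]|xv].
    by rewrite -(t_coh y x py px lab_y v pv).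
  by exists x; rewrite px eqxx.
have lin1 : cw_linear (cw_union t (cw_vertex l0)).
  by rewrite /= t_lin card_unit orbT.
have [t' t'_lin t'_real] :=
  realizes_joins lin1 (realizes_add_vertex l0 pv t_real) ls_l0.
exists t', lab'; split=> //; last first.
  move=> x y /= /predU1P[->|px] /predU1P[->|py] // eq_l z.
  - by move: (free y py); rewrite -(lab'p y) // -eq_l /lab' eqxx eqxx.
  - by move: (free x px); rewrite -(lab'p x) // eq_l /lab' eqxx eqxx.
  by case/norP=> _ pz; apply: t_coh => //; rewrite -!lab'p.
apply: eq_realizes t'_real _ _ _ => // x y /= px py.
have neq_v z : p z -> (z == v) = false.
  by move=> pz; apply: contraNF pv => /eqP <-.
case/predU1P: px py => [->|px] /predU1P[->|py].
- by rewrite !eqxx (negPf ls_l0) adj_irr.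
- by rewrite !eqxx neq_v //= andbF /= adj_ls // (negPf (free y py))
     andbF orbF adj_sym.
- by rewrite !eqxx neq_v //= andbF /= adj_ls // andbT (negPf (free x px)).
rewrite !neq_v //= !andbT (negPf (free x px)) (negPf (free y py)).
by rewrite andbF !orbF.
Qed.

End Realize.

(** Add the vertices by increasing [r].  Before each of them, the coherent key
bounds the number of labels that have to be kept apart, so one label beyond
the number of keys is enough. *)
Lemma lcw_of_layout (G : sgraph) (T : finType) (r : G -> nat) :
  injective r ->
  (forall m, exists key : G -> T, coherent (@adj G) (fun x => r x < m) key) ->
  lcw_constructible G #|T|.+1.
Proof.
move=> r_inj keys.
suff prefix m : exists (t : cwexpr #|T|.+1) (lab : G -> 'I_#|T|.+1),
    [/\ cw_linear t, realizes t (fun x => r x < m) (@adj G) lab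
      & coherent (@adj G) (fun x => r x < m) lab].
  have [t [lab [t_lin [g [g_inj g_im g_e _]] _]]] := prefix (\max_x r x).+1.
  exists t => //.
  have im x : {y | g y = x}.
    by apply: cid; apply/g_im; rewrite ltnS; apply: leq_bigmax.
  exists (fun x => sval (im x)).
    exists g => [x|y]; first exact: svalP (im x).
    by apply: g_inj; apply: svalP (im (g y)).
  by move=> x y; rewrite -g_e (svalP (im x)) (svalP (im y)).
elim: m => [|m [t [lab [t_lin t_real t_coh]]]].
  exists cw_empty, (fun _ => ord0); split=> //.
  by exists (fun x : void => match x with end);
     split=> [[]|x|[]|[]] //; split=> // [[[]]].
have [[v rv]|nov] := pselect (exists v, r v = m); last first.
  have eq_p : (fun x => r x < m) =1 (fun x => r x < m.+1).
    move=> x; rewrite ltnS [RHS]leq_eqVlt orbC.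
    by case: (r x =P m) => [rx|_]; [case: nov; exists x | rewrite orbF].
  exists t, lab; split=> //; first exact: eq_realizes t_real _ _ _.
  by move=> x y; rewrite -!eq_p => px py eq_l z; rewrite -eq_p; apply: t_coh.
have [key key_coh] := keys m.
have [t1 [lab1 [l0 [t1_lin t1_real t1_coh free]]]] :=
  free_label (ltnSn _) t_lin t_real t_coh key_coh.
have pv : ~~ (r v < m) by rewrite rv ltnn.
have [t' [lab' [t'_lin t'_real t'_coh]]] :=
  realizes_extend t1_lin t1_real t1_coh free pv.
have eq_p : predU1 v (fun x => r x < m) =1 (fun x => r x < m.+1).
  by move=> x /=; rewrite ltnS [RHS]leq_eqVlt -rv (inj_eq r_inj).
exists t', lab'; split=> //; first exact: eq_realizes t'_real _ _ _.
by move=> x y; rewrite -!eq_p => px py eq_l z; rewrite -eq_p; apply: t'_coh.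
Qed.

(** * Coherent keys from bounded similarity *)

Lemma similarity_key (G : sgraph) (U : {set G}) N : mu U <= N ->
  exists key : G -> 'I_N.+1, coherent (@adj G) (fun x => x \in U) key.
Proof.
move=> muN; pose P := equivalence_partition (similar U) U.
pose cls x := [set y in U | similar U x y].
have clsP x : x \in U -> cls x \in P by move=> Ux; apply/imsetP; exists x.
exists (fun x => inord (index (cls x) (enum P))) => x y Ux Uy eq_k z Uz.
have bound u : u \in U -> index (cls u) (enum P) < N.+1.
  by move=> Uu; rewrite ltnS (leq_trans _ muN) // /mu cardE index_size.
have : y \in cls x.
  have eq_i : index (cls x) (enum P) = index (cls y) (enum P).
    by move/(congr1 val): eq_k; rewrite /= !inordK ?bound.
  rewrite -(nth_index (cls x) (_ : cls x \in enum P)) ?mem_enum ?clsP //.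
  rewrite eq_i nth_index ?mem_enum ?clsP // inE Uy.
  by apply/forall_inP.
by rewrite inE Uy => /forall_inP/(_ z); rewrite inE => /(_ Uz)/eqP.
Qed.

Lemma in_segment a n i : (i \in segment a n) = (a <= i < a + n).
Proof. by rewrite /segment in_fset /= mem_iota. Qed.

(** The bound on the bond-graphs of all the segments [0, n) also bounds, for
any [m], the number of types of the columns before [m] towards those from [m]
to any given limit. *)
Lemma bond_key (b : bond_set) : bounded_M b ->
  exists M, forall m n, exists key : nat -> 'I_M.+1, forall i i' j,
    i < m -> i' < m -> m <= j < n -> key i = key i' -> b i j = b i' j.
Proof.
case=> M MP; exists M => m n.
have [m0|m_gt0] := posnP m.
  by exists (fun=> ord0) => i i' j; rewrite m0.
have [nm|mn] := leqP n m.
  by exists (fun=> ord0) => i i' j _ _ /andP[mj /(leq_ltn_trans mj)];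
     rewrite ltnNge nm.
pose B := bond_graph b (segment 0 n).
have muM : mu [set u : B | val u \in segment 0 m] <= M.
  have n2 : 2 <= n by apply: leq_trans mn.
  apply: leq_trans (ltnW (MP n n2)); rewrite /Mparam.
  by rewrite (bigD1_seq m) /= ?mem_index_iota ?m_gt0 ?iota_uniq // leq_maxl.
have [key keyP] := similarity_key muM.
exists (fun i => if insub i is Some u then key u else ord0) => i i' j im i'm mjn.
have seg l : l < n -> l \in segment 0 n by rewrite in_segment.
have si := seg i (ltn_trans im mn); have si' := seg i' (ltn_trans i'm mn).
have sj : j \in segment 0 n by rewrite seg //; case/andP: mjn.
rewrite (insubT (fun i => i \in segment 0 n) si).
rewrite (insubT (fun i => i \in segment 0 n) si').
move/keyP => /(_ _ _ (FSetSub sj)) /=; apply; rewrite inE /= in_segment //=.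
by rewrite add0n -leqNgt; case/andP: mjn.
Qed.

Lemma row_key (d : delta_triple) (Q : {fset nat}) N : Nparam d Q <= N ->
  exists key : nat -> 'I_N.+1, forall i i' j,
    i \in Q -> i' \in Q -> j \in Q -> key i = key i' ->
    P_adj d (i, 0) (j, 1) = P_adj d (i', 0) (j, 1).
Proof.
move/similarity_key => [key keyP].
pose V := (vrow 0 Q `|` vrow 1 Q)%fset.
have in_vrow r i s : ((i, s) \in vrow r Q) = (i \in Q) && (s == r).
  apply/imfsetP/andP => /= [[l lQ [-> ->]]|[iQ /eqP->]]; last by exists i.
  by rewrite eqxx.
have v0 i : i \in Q -> (i, 0) \in V by move=> iQ; rewrite in_fsetU !in_vrow iQ.
have v1 i : i \in Q -> (i, 1) \in V by move=> iQ; rewrite in_fsetU !in_vrow iQ orbT.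
exists (fun i => if insub (i, 0) is Some u then key u else ord0) => i i' j iQ i'Q jQ.
rewrite (insubT (fun v => v \in V) (v0 i iQ)).
rewrite (insubT (fun v => v \in V) (v0 i' i'Q)).
move/keyP => /(_ _ _ (FSetSub (v1 j jQ))) /=; apply;
  rewrite inE /= in_vrow ?iQ ?i'Q //.
by rewrite andbF.
Qed.

(** * Cutting a strip of columns between crossings *)

(** A strip has columns [0], ..., [m]; [pt i p] says that there is a vertex in
column [i] and row [p], and [eqstep i] that the letter between the columns [i]
and [i.+1] is 0 or 1. *)
Section Strip.
Variables (m : nat) (pt : nat -> nat -> Prop) (eqstep : pred nat).

(** The letters 2 and 3 get the same condition: stacked crossings have to
reproduce [j >= k] for the former and [j < k] for the latter, and these two
are complementary. *)
Definition step i p q := if eqstep i then p == q else q <= p.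

Definition crossing (X : pred nat) (f : nat -> nat) : Prop :=
  (forall i, i <= m -> pt i (f i) /\ X (f i)) /\
  (forall i, i < m -> step i (f i) (f i.+1)).

Definition stack n (f : nat -> nat -> nat) : Prop :=
  (forall r, r < n -> crossing predT (f r)) /\
  (forall r s, r < s < n -> forall i j, i <= m -> j <= m -> f r i < f s j).

Section Interval.
Variable X : pred nat.

Fixpoint reached i p : Prop :=
  match i with
  | 0 => pt 0 p /\ X p
  | i'.+1 => [/\ pt i p, X p & exists2 q, reached i' q & step i' q p]
  end.

(** The points that have to accompany the reached ones; see [left_side].  The
fuel [c] is the number of columns to the right of the column [i]. *)
Fixpoint below c i p : Prop :=
  match c with
  | 0 => False
  | c'.+1 => if eqstep i then pt i.+1 p /\ below c' i.+1 p
             else exists2 q, p <= q & reached i q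
  end.

(** The reached points alone are no good left side: before a step of
inequality, an unreached point below a reached one sees the left part of the
next column in an arbitrary way.  Such points have to move to the left, and
with them everything linked to them by equality steps on their left. *)
Definition left_side i p := reached i p \/ below (m - i) i p.

Lemma reached_crossing p : reached m p -> exists f, crossing X f.
Proof.
suff H i q : reached i q -> exists f, [/\ f i = q,
    forall j, j <= i -> pt j (f j) /\ X (f j)
    & forall j, j < i -> step j (f j) (f j.+1)].
  by case/H => f [_ f1 f2]; exists f.
elim: i q => [|i IHi] q /=.
  by move=> [Sq Xq]; exists (fun=> q); split=> // -[].
case=> Sq Xq [q' /IHi[f [fi f1 f2]] qq'].
exists (fun j => if j <= i then f j else q); split; first by rewrite ltnn.
  move=> j; case: (leqP j i) => [ji _|ij ji]; first exact: f1.
  by have -> : j = i.+1 by apply/eqP; rewrite eqn_leq ij ji.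
move=> j; rewrite ltnS => ji; rewrite ji; case: ltngtP ji => // [ji _|-> _].
  exact: f2.
by rewrite fi.
Qed.

Lemma reached_le i j p : i <= j -> reached j p ->
  exists2 q, p <= q & reached i q.
Proof.
move/subnKC <-; elim: (j - i) p => [|c IHc] p; first by rewrite addn0; exists p.
rewrite addnS /= => -[_ _ [q /IHc[q' qq' q'r] st]]; exists q' => //.
apply: leq_trans qq'; move: st; rewrite /step; case: ifP => // _ /eqP->.
exact: leqnn.
Qed.

Lemma below_le c i j p : i <= j -> below c j p ->
  exists2 q, p <= q & reached i q.
Proof.
elim: c j => // c IHc j ij /=; case: ifP => _.
  by case=> _; apply: IHc; apply: leqW.
case=> q pq /(reached_le ij)[q' qq' q'r]; exists q' => //.
exact: leq_trans qq'.
Qed.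

Lemma left_side0 p : pt 0 p -> X p -> left_side 0 p.
Proof. by left. Qed.

Lemma left_side_last p : left_side m p -> reached m p.
Proof. by case=> //; rewrite subnn. Qed.

Lemma left_side_eqstep i p : i < m -> eqstep i -> pt i p -> pt i.+1 p -> X p ->
  left_side i p <-> left_side i.+1 p.
Proof.
move=> im ei Sp Sp' Xp; rewrite /left_side -(subnSK im) /= ei.
split=> [[ri|[_ b]]|[[_ _ [q ri]]|b]]; try by [right|right; split].
  by left; split=> //; exists p => //; rewrite /step ei.
by rewrite /step ei => /eqP <-; left.
Qed.

(** Around a step of inequality, the left side in both columns consists of the
rows up to the highest reached one of the first column; for the second column,
treated next, this uses that crossings go down weakly. *)
Lemma left_side_lestep i p : i < m -> ~~ eqstep i -> pt i p ->
  left_side i p <-> exists2 q, p <= q & reached i q.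
Proof.
move=> im /negPf ei Sp; rewrite /left_side -(subnSK im) /= ei.
by split=> [[r|//]|[q pq r]]; [exists p | right; exists q].
Qed.

Lemma left_side_lestep_next i p : i < m -> ~~ eqstep i -> pt i.+1 p -> X p ->
  left_side i.+1 p <-> exists2 q, p <= q & reached i q.
Proof.
move=> im /negPf ei Sp Xp; rewrite /left_side; split.
  by case=> [/(reached_le (leqnSn i))|/(below_le (leqnSn i))].
by case=> q pq r; left; split=> //; exists q => //; rewrite /step ei.
Qed.

End Interval.

(** Take the lowest [h'] such that the rows [h], ..., [h'] contain a crossing.
The rows before [h'] contain none, [h'] is a single row, and the argument is
repeated above [h'] for one crossing less.  The value of [idx] at a row is the
number of its interval. *)
Lemma strip_partition n h :
  (exists f, stack n f /\ forall r i, r < n -> i <= m -> h <= f r i) \/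
  exists idx : nat -> nat,
    [/\ {homo idx : p q / p <= q}, forall p, idx p < n.*2
      & forall p, h <= p -> (forall q, h <= q -> idx p = idx q -> p = q) \/
          ~ exists f, crossing (fun q => (h <= q) && (idx q == idx p)) f].
Proof.
elim: n h => [|n IHn] h; first by left; exists (fun _ _ => 0); split;
    [split=> // r s /andP[]|].
have [[f0 f0P]|none] := pselect (exists f, crossing (leq h) f); last first.
  right; exists (fun=> 0); split=> // p hp; right=> -[f [f1 f2]]; apply: none.
  by exists f; split=> // i /f1[? /= /andP[]].
have crossed : exists h', `[< exists f, crossing (fun q => h <= q <= h') f >].
  exists (\max_(i < m.+1) f0 i); apply/asboolP; exists f0.
  case: f0P => f1 f2; split=> // i im; have [? ->] := f1 i im; split=> //=.
  exact: (leq_bigmax (Ordinal (im : i < m.+1))).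
case: (ex_minnP crossed) => h' /asboolP[f1 f1P] min_h'.
have hh' : h <= h'.
  by have [_ /= /andP[h0 h1]] := f1P.1 0 (leq0n m); apply: leq_trans h0 h1.
have [[f [[fP f_lt] f_ge]]|[idx [idx_mono idx_lt idxP]]] := IHn h'.+1.
  left; exists (fun r => if r is r'.+1 then f r' else f1); split; last first.
    move=> [|r] i /= rn im; first by have [_ /= /andP[]] := f1P.1 i im.
    by apply: leq_trans (f_ge r i rn im); apply: leqW.
  split=> [[|r] rn|[|r] [|s] //= sn i j im jm].
  - by case: f1P => f11 f12; split=> // i /f11[].
  - exact: fP.
  - have [_ /= /andP[_ fh']] := f1P.1 i im.
    by apply: leq_trans (f_ge s j sn jm); rewrite ltnS.
  exact: f_lt.
right; exists (fun p => if p < h' then 0 else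
                        if p == h' then 1 else (idx p).+2); split.
- move=> p q pq; have := idx_mono _ _ pq.
  by case: (ltngtP p h'); case: (ltngtP q h') => //; lia.
- by move=> p; have := idx_lt p; case: (ltngtP p h') => //; lia.
move=> p hp; case: (ltngtP p h') => [ph|ph|ph]; last first.
- by left=> q hq; case: (ltngtP q h') => // ->.
- have [single|pathless] := idxP p ph; [left=> q hq|right=> -[f [f1' f2]]].
    by case: (ltngtP q h') => // qh [] /single; apply.
  apply: pathless; exists f; split=> // i /f1'[Sf].
  by case: (ltngtP (f i) h') => [|fh|]; rewrite ?andbF //= !eqSS => /andP[_ ->].
- right=> -[f [f1' f2]].
  suff /min_h' : `[< exists f, crossing (fun q => h <= q <= h'.-1) f >] by lia.
  apply/asboolP; exists f; split=> // i /f1'[Sf].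
  by case: (ltngtP (f i) h') => [fh|fh|_]; rewrite ?andbF //= => /andP[-> _];
     split=> //=; lia.
Qed.

(** [L] is the left side in the intervals without crossings, and everything in
those with a single row.  Two points of neighbouring columns, in the same
interval but on different sides, are then compared in a way that determines
their adjacency. *)
Lemma strip_cut n : (forall f, ~ stack n f) ->
  exists (idx : nat -> nat) (L : nat -> nat -> bool),
    [/\ {homo idx : p q / p <= q}, forall p, idx p < n.*2,
        forall p, pt 0 p -> L 0 p,
        forall p q, L m p -> idx p = idx q -> p = q
      & forall i p q, i < m -> pt i p -> pt i.+1 q -> idx p = idx q ->
          L i p != L i.+1 q ->
          if eqstep i then p != q else if L i p then p < q else q < p].
Proof.
move=> nostack; have [[f [/nostack]] //|[idx [idx_mono idx_lt idxP]]] :=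
  strip_partition n 0.
pose single p := forall q, idx p = idx q -> p = q.
pose X p := fun q => idx q == idx p.
pose L i p := `[< single p \/ left_side (X p) i p >].
exists idx, L; split=> //.
- by move=> p Sp; apply/asboolP; right; apply: left_side0 => //; apply: eqxx.
- move=> p q /asboolP[single_p /single_p //|/left_side_last/reached_crossing cr].
  by case: (idxP p (leq0n p)) => [sp|/(_ cr) //]; move/sp; apply.
move=> i p q im Sp Sq eq_idx; rewrite /L.
have -> : X q = X p by rewrite /X eq_idx.
have [sp|nsp] := pselect (single p).
  have eq_pq := sp q eq_idx; rewrite -eq_pq.
  by rewrite !asboolT ?eqxx //; left.
have nsq : ~ single q.
  by move=> sq; apply: nsp; rewrite -(sq p (esym eq_idx)).
have or_sp r (Q : Prop) : ~ single r -> (single r \/ Q) = Q.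
  by move=> nsr; apply/propext; split=> [[]|]; [|by []|right].
rewrite !or_sp //; case: ifP => [ei|/negbT ei].
  apply: contraNneq => eq_pq; rewrite -eq_pq in Sq *.
  apply/eqP; apply: asbool_equiv_eq.
  by apply: left_side_eqstep; rewrite // /X.
have Xq : X p q by rewrite /X eq_idx.
rewrite (asbool_equiv_eq (left_side_lestep (X p) im ei Sp)).
rewrite (asbool_equiv_eq (left_side_lestep_next im ei Sq Xq)).
case: (asboolP (exists2 _, p <= _ & _)) => [[r pr ri]|nr].
  case: (asboolP (exists2 _, q <= _ & _)) => // nr _.
  by rewrite ltnNge; apply/negP => qp; apply: nr; exists r;
     rewrite // (leq_trans qp).
case: (asboolP (exists2 _, q <= _ & _)) => // -[r qr ri] _.
by rewrite ltnNge; apply/negP => pq; apply: nr; exists r;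
   rewrite // (leq_trans pq).
Qed.

End Strip.

(** * Crossings and cuts in the infinite graph *)

Definition eqletter (a : 'I_4) : bool := val a < 2.

Lemma letter_adj_eq a p q p' q' : eqletter a -> (p == q) = (p' == q') ->
  letter_adj a p q = letter_adj a p' q'.
Proof.
by case: a => [[|[|a]] lt_a] // _ eq_pq; rewrite /letter_adj /= eq_pq.
Qed.

Lemma letter_adj_lt a p q p' q' : ~~ eqletter a -> (p < q) = (p' < q') ->
  letter_adj a p q = letter_adj a p' q'.
Proof.
by case: a => [[|[|[|a]]] lt_a] // _ eq_pq; rewrite /letter_adj /=
   ?(leqNgt q) ?(leqNgt q') eq_pq.
Qed.

Section Columns.
Variable d : delta_triple.

Lemma P_adj_col i p q : P_adj d (i, p) (i, q) = gamma d i && (p != q).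
Proof. by rewrite /P_adj /= eqxx. Qed.

Lemma P_adj_next i p q :
  P_adj d (i, p) (i.+1, q) = letter_adj (alpha d i) p q.
Proof. by rewrite /P_adj /= eqxx ifF //; lia. Qed.

Lemma P_adj_far i j p q : (i.+1 < j) || (j.+1 < i) ->
  P_adj d (i, p) (j, q) = beta d i j.
Proof. by move=> far; rewrite /P_adj /= !ifF //; lia. Qed.

(** Between two different rows, the adjacency depends only on the columns and
on which row is the lower one: all letters compare rows by order or by
equality. *)
Lemma P_adj_rows i j p q p' q' : p < q -> p' < q' ->
  P_adj d (i, p) (j, q) = P_adj d (i, p') (j, q').
Proof.
move=> pq pq'; have letter_lt a : letter_adj a p q = letter_adj a p' q'.
  have [?|?] := boolP (eqletter a).
    by apply: letter_adj_eq => //; rewrite !ltn_eqF.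
  by apply: letter_adj_lt => //; rewrite pq pq'.
have letter_gt a : letter_adj a q p = letter_adj a q' p'.
  have [?|?] := boolP (eqletter a).
    by apply: letter_adj_eq => //; rewrite !gtn_eqF.
  by apply: letter_adj_lt => //; rewrite !ltnNge (ltnW pq) (ltnW pq').
by rewrite /P_adj /= (ltn_eqF pq) (ltn_eqF pq') letter_lt letter_gt.
Qed.

(** Points of different crossings of a stack are ordered like the indices of the
crossings, and along one crossing the step condition gives neighbouring
columns the adjacency of two points in the same row. *)
Lemma stack_P_adj m a n f pt i j r s : same_factor d m.+1 0 a ->
  stack m pt (fun i => eqletter (alpha d (a + i))) n f ->
  i <= m -> j <= m -> r < n -> s < n ->
  P_adj d (a + i, f r i) (a + j, f s j) = P_adj d (i, r) (j, s).
Proof.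
case=> same_alpha same_gamma same_beta [f_cr f_lt].
wlog ij : i j r s / i <= j => [H im jm rn sn|].
  have [ij|/ltnW ij] := leqP i j; first exact: H.
  by rewrite P_sym [RHS]P_sym; apply: H.
move=> im jm rn sn; have [i_lt|ji|eq_ij] := ltngtP i j; last 1 first.
- rewrite -eq_ij !P_adj_col -(same_gamma i) //; congr andb.
  have [rs|sr|->] := ltngtP r s; last by rewrite eqxx.
    by rewrite ltn_eqF // f_lt // rs.
  by rewrite gtn_eqF // f_lt // sr.
- have [far|ji] := ltnP i.+1 j; last first.
    have {i_lt ij ji} eq_j : j = i.+1 by lia.
    subst j; rewrite addnS !P_adj_next -(same_alpha i) //.
    have [rs|sr|eq_rs] := ltngtP r s.
    + have := P_adj_rows i i.+1 (f_lt r s _ i i.+1 im jm) rs.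
      by rewrite !P_adj_next rs; apply.
    + have fsr : f s i.+1 < f r i by apply: f_lt; rewrite // sr.
      have := P_adj_rows i.+1 i fsr sr.
      by rewrite ![P_adj d (i.+1, _) _]P_sym !P_adj_next.
    rewrite -eq_rs; have := (f_cr r rn).2 i jm; rewrite /step -(same_alpha i) //.
    case: ifP => [eq_l /eqP <-|/negbT le_l f_le].
      by apply: letter_adj_eq; rewrite ?eqxx.
    by apply: letter_adj_lt => //; rewrite ltnn ltnNge f_le.
  rewrite !P_adj_far ?far //; last by lia.
  by rewrite -(same_beta i j im jm).
by move: ji; rewrite ltnNge ij.
Qed.

Definition cell (V : Type) (g : V -> nat * nat) (a i p : nat) : Prop :=
  exists u, g u = (a + i, p).

Lemma stack_induced (F G : sgraph) (e : F -> nat * nat) (g : G -> nat * nat)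
    m n a f :
  injective e -> {mono e : x y / adj x y >-> P_adj d x y} ->
  {mono g : x y / adj x y >-> P_adj d x y} ->
  (forall x, (e x).1 <= m) -> (forall x, (e x).2 < n) ->
  same_factor d m.+1 0 a ->
  stack m (cell g a) (fun i => eqletter (alpha d (a + i))) n f ->
  induced_in (@adj F) (@adj G).
Proof.
move=> e_inj e_mono g_mono em en same fP.
have img x : {u | g u = (a + (e x).1, f (e x).2 (e x).1)}.
  by apply: cid; apply: ((fP.1 _ (en x)).1 _ (em x)).1.
exists (fun x => sval (img x)) => [x y eq_xy|x y]; last first.
  by rewrite -g_mono (svalP (img x)) (svalP (img y)) (stack_P_adj same fP)
     // -!surjective_pairing.
have := svalP (img x); rewrite eq_xy (svalP (img y)) => -[/addnI eq1].
rewrite eq1 => eq2; apply: e_inj.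
rewrite (surjective_pairing (e x)) (surjective_pairing (e y)) eq1; congr pair.
have row_inj u v : f (e u).2 (e x).1 = f (e v).2 (e x).1 -> (e v).2 <= (e u).2.
  move=> eq_f; rewrite leqNgt; apply/negP => lt_uv.
  have := fP.2 _ _ (introT andP (conj lt_uv (en v))) _ _ (em x) (em x).
  by rewrite eq_f ltnn.
by apply/eqP; rewrite eqn_leq (row_inj y x eq2) (row_inj x y (esym eq2)).
Qed.

(** Vertices before the strip see the right part only through bonds, because the
cut leaves the whole first column of the strip on the left.  For the vertices
of the strip, column and interval determine the neighbourhood on the right. *)
Lemma vertical_cut (V : Type) (g : V -> nat * nat) m n a W M
    (bkey : nat -> 'I_M.+1) :
  (forall i i' j, i < a -> i' < a -> a <= j < W -> bkey i = bkey i' ->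
     beta d i j = beta d i' j) ->
  (forall u, (g u).1 < W) ->
  (forall f, ~ stack m (cell g a) (fun i => eqletter (alpha d (a + i))) n f) ->
  exists (L : pred V) (key : V -> 'I_M.+1 + 'I_m.+1 * 'I_(n.*2).+1),
    [/\ forall u, (g u).1 < a -> L u, forall u, L u -> (g u).1 <= a + m
      & coherent (fun u v => P_adj d (g u) (g v)) L key].
Proof.
move=> bkeyP gW /strip_cut[idx [L [idx_mono idx_lt L0 Lm L_step]]].
exists (fun u => ((g u).1 < a) || ((g u).1 <= a + m) && L ((g u).1 - a) (g u).2).
exists (fun u => if (g u).1 < a then inl (bkey (g u).1)
                 else inr (inord ((g u).1 - a), inord (idx (g u).2))).
split=> [u ->|u /orP[|/andP[]]|] //; first by lia.
move=> u v Lu Lv eq_key z; rewrite negb_or -leqNgt => /andP[az Lz].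
have Sz: cell g a ((g z).1 - a) (g z).2.
  by exists z; rewrite subnKC // -surjective_pairing.
(* The column [a] lies on the left, so [z] is at distance at least 2 from the
   columns before [a]. *)
have az0 : a < (g z).1.
  rewrite ltn_neqAle az andbT; apply/negP => /eqP eq_a; move: Lz Sz.
  by rewrite -eq_a leq_addr /= subnn => /negP nL /L0.
move: Lu Lv eq_key; case: (ltnP (g u).1 a) => au; case: (ltnP (g v).1 a) => av //.
  move=> _ _ [eq_key].
  rewrite (surjective_pairing (g u)) (surjective_pairing (g v)).
  rewrite (surjective_pairing (g z)) !P_adj_far; try lia.
  by apply: bkeyP => //; rewrite az gW.
move=> /= /andP[um Lu] /andP[vm Lv] [/(congr1 val) + /(congr1 val)].
rewrite /= !inordK ?ltnS ?leq_subLR ?(ltnW (idx_lt _)) // => eq_c eq_idx.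
have Su: cell g a ((g u).1 - a) (g u).2.
  by exists u; rewrite subnKC // -surjective_pairing.
have Sv: cell g a ((g v).1 - a) (g v).2.
  by exists v; rewrite subnKC // -surjective_pairing.
move: Lu Lv Lz Su Sv Sz um vm; rewrite -eq_c.
have -> : g u = (a + ((g u).1 - a), (g u).2).
  by rewrite subnKC // -surjective_pairing.
have -> : g v = (a + ((g u).1 - a), (g v).2).
  by rewrite eq_c subnKC // -surjective_pairing.
have -> : g z = (a + ((g z).1 - a), (g z).2).
  by rewrite subnKC // -surjective_pairing.
rewrite /= !addKn !leq_add2l.
move: ((g u).1 - a) ((g z).1 - a) eq_idx => i j.
move: (g u).2 (g v).2 (g z).2 => p p' q eq_idx Lp Lp' Lq Sp Sp' Sq im _.
have idx_cmp r : idx r != idx q -> (r < q) = (idx r < idx q).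
  case: (ltngtP r q) => [/ltnW/idx_mono|/ltnW/idx_mono|->]; rewrite ?eqxx //; lia.
(* Only points in the interval of [q] need the properties of the cut: the
   other intervals lie entirely above or entirely below [q]. *)
have same_letters l :
    (forall r, cell g a i r -> L i r -> idx r = idx q ->
       if eqletter (alpha d (a + l)) then r != q else r < q) ->
    letter_adj (alpha d (a + l)) p q = letter_adj (alpha d (a + l)) p' q /\
    letter_adj (alpha d (a + l)) q p = letter_adj (alpha d (a + l)) q p'.
  move=> lP; have [eq_q|neq_q] := eqVneq (idx p) (idx q).
    have := lP p Sp Lp eq_q; have := lP p' Sp' Lp' (etrans (esym eq_idx) eq_q).
    case: ifP => [el|/negbT nel] np' np.
      by split; apply: letter_adj_eq => //;
         rewrite ?[q == _]eq_sym (negPf np) (negPf np').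
    by split; apply: letter_adj_lt; rewrite // ?np ?np' //
       !ltnNge (ltnW np) (ltnW np').
  have eq_lt : (p < q) = (p' < q) by rewrite !idx_cmp -?eq_idx.
  have neq r : idx r != idx q -> r == q = false.
    by move=> neq_r; apply: contraNF neq_r => /eqP->.
  have [el|el] := boolP (eqletter (alpha d (a + l))).
    by split; apply: letter_adj_eq; rewrite // ?[q == _]eq_sym !neq // -eq_idx.
  split; apply: letter_adj_lt => //.
  by have := neq p neq_q; have := neq p'; rewrite -eq_idx => /(_ neq_q); lia.
have [ij|ji|eq_ij] := ltngtP i j; last 1 first.
- rewrite -eq_ij im /= in Lq *; rewrite !P_adj_col.
  have neq r : L i r -> r != q by case: eqP => // -> /(negP Lq).
  by rewrite !neq.
- have [far|] := ltnP i.+1 j; first by rewrite !P_adj_far //; lia.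
  rewrite leq_eqVlt ltnS leqNgt ij orbF => /eqP eq_j.
  subst j; rewrite addnS !P_adj_next.
  (* Left vertices of the last column are alone in their interval. *)
  have [/eqP eq_m|neq_m] := boolP (i == m).
    by rewrite (Lm p p') // -eq_m.
  have {}im : i < m by lia.
  rewrite im /= in Lq; apply: (same_letters i _).1 => r Sr Lr eq_r.
  by have := L_step i r q im Sr Sq eq_r; rewrite Lr (negPf Lq) => /(_ isT).
have [far|] := ltnP j.+1 i; first by rewrite !P_adj_far //; lia.
rewrite leq_eqVlt ltnS leqNgt ji orbF => /eqP eq_i.
subst i; rewrite P_sym [RHS]P_sym addnS !P_adj_next.
rewrite (ltnW im) /= in Lq; apply: (same_letters j _).2 => r Sr Lr eq_r.
have := L_step j q r im Sq Sr (esym eq_r).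
by rewrite Lr (negPf Lq) [q == r]eq_sym => /(_ isT).
Qed.

End Columns.

(** * Ordering the chunks between the cuts *)

Lemma min_nat (P : nat -> Prop) : (exists n, P n) -> exists n, is_minimum P n.
Proof.
case=> n0 Pn0; have exP : exists n, `[< P n >] by exists n0; apply/asboolP.
case: (ex_minnP exP) => n /asboolP Pn n_min; exists n; split=> // j Pj.
by apply: n_min; apply/asboolP.
Qed.

Lemma occurrences (d : delta_triple) k : recurrent d -> 2 <= k ->
  exists a : nat -> nat, a 0 = 0 /\ forall t, gap_factor d k 0 (a t) (a t.+1).
Proof.
move=> rec k2.
have next b : {c | is_minimum (fun c => b + k <= c /\ same_factor d k 0 c) c}.
  apply: cid; apply: min_nat; have [c] := rec k 0 k2 (b + k).
  by exists c.
pose a t := iter t (fun b => sval (next b)) 0.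
have aP t : a t + k <= a t.+1 /\ same_factor d k 0 (a t.+1).
  by case: (svalP (next (a t))).
exists a; split=> // t; split; try by case: (aP t).
  by case: t => [|t]; [split | case: (aP t)].
move=> c /andP[far lt_c] same; have := (svalP (next (a t))).2 c (conj far same).
by rewrite leqNgt lt_c.
Qed.

Lemma ltn_digits W a b x : b < W ->
  (a * W + b < x) = (a < x %/ W) || (a == x %/ W) && (b < x %% W).
Proof.
move=> bW; have W0 : 0 < W by apply: leq_trans bW.
rewrite {1}(divn_eq x W); have := ltn_pmod x W0.
move: (x %/ W) (x %% W) => c e eW.
have [ac|ca|->] := ltngtP a c; last by rewrite ltn_add2l.
  by have := leq_mul2r W a.+1 c; rewrite ac orbT mulSn => /idP; lia.
by have := leq_mul2r W c.+1 a; rewrite ca orbT mulSn => /idP; lia.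
Qed.

Lemma digits_inj W a b a' b' : b < W -> b' < W ->
  a * W + b = a' * W + b' -> a = a' /\ b = b'.
Proof.
move=> bW b'W eq_ab; have W0 : 0 < W by apply: leq_trans bW.
have := congr1 (divn^~ W) eq_ab; have := congr1 (modn^~ W) eq_ab.
by rewrite /= !modnMDl !divnMDl // !modn_small // !divn_small // !addn0.
Qed.

(** [L t] is the left part of the cut through the occurrence at [a t]; it is
empty for [t = 0], so that every vertex lies in a chunk between some [L t] and
[L t.+1], that is, on the columns of the gap factor from [a t] to [a t.+1]. *)
Section Layout.
Variables (d : delta_triple) (G : sgraph) (g : G -> nat * nat).
Hypotheses (g_inj : injective g)
           (g_mono : {mono g : x y / adj x y >-> P_adj d x y}).
Variables (m M N : nat) (Tc : finType) (a : nat -> nat).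
Hypothesis bkeyP : forall l n, exists bkey : nat -> 'I_M.+1, forall i i' j,
  i < l -> i' < l -> l <= j < n -> bkey i = bkey i' -> beta d i j = beta d i' j.
Hypothesis gapP : forall t, gap_factor d m.+1 0 (a t) (a t.+1).
Hypothesis gapN : forall t,
  Nparam d (segment (a t) (a t.+1 + m.+1 - a t)) <= N.
Variables (L : nat -> pred G) (ckey : nat -> G -> Tc).
Hypothesis L0 : forall u, ~~ L 0 u.
Hypothesis L_gt : forall t u, (g u).1 < a t -> L t u.
Hypothesis L_le : forall t u, L t u -> (g u).1 <= a t + m.
Hypothesis ckeyP : forall t, coherent (@adj G) (L t) (ckey t).

Let Tkey : finType := (Tc + Tc * 'I_N.+1 * 'I_M.+1 * bool * bool)%type.

(** The rank [r] of a vertex is the number with digits (chunk, row, column).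
For an initial segment ending at (T0, J, I), the vertices of earlier chunks are
keyed by the cut before the chunk [T0], and those of this chunk by the cut
after it, which handles the later chunks, together with [nkey] for the rows
above and [bkey] for the rest of the row [J]. *)
Lemma layout_lcw : lcw_constructible G #|Tkey|.+1.
Proof.
have a_step t : a t + m.+1 <= a t.+1 by case: (gapP t).
have a_ge t : t <= a t by elim: t => // t IHt; have := a_step t; lia.
have L_next t u : L t u -> L t.+1 u.
  by move/L_le => le_u; apply: L_gt; have := a_step t; lia.
have L_mono s t u : s <= t -> L s u -> L t u.
  move/subnKC <-; elim: (t - s) => [|c IHc]; first by rewrite addn0.
  by rewrite addnS => /IHc/L_next.
have ex_chunk u : exists t, L t.+1 u.
  by exists (g u).1; apply: L_gt; apply: leq_trans (a_ge _).
pose chunk u := ex_minn (ex_chunk u).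
have chunk_lt u t : (chunk u < t) = L t u.
  rewrite /chunk; case: ex_minnP => c Lc c_min; apply/idP/idP.
    by move/L_mono; apply.
  by case: t => [|t]; [rewrite (negPf (L0 u)) | move/c_min].
pose W := (\max_u (g u).1).+1; pose H := (\max_u (g u).2).+1.
have gW u : (g u).1 < W.
  by rewrite ltnS (@leq_bigmax G (fun u => (g u).1)).
have gH u : (g u).2 < H.
  by rewrite ltnS (@leq_bigmax G (fun u => (g u).2)).
pose r u := (chunk u * H + (g u).2) * W + (g u).1.
apply: (@lcw_of_layout G Tkey r).
  move=> u v /digits_inj[//|//|/digits_inj[//|//|_ eq2] eq1].
  by apply: g_inj; rewrite (surjective_pairing (g u)) eq1 eq2 -surjective_pairing.
move=> x; pose T0 := x %/ W %/ H; pose J := x %/ W %% H; pose I := x %% W.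
have r_lt u : (r u < x) = (chunk u < T0) || (chunk u == T0) &&
    (((g u).2 < J) || ((g u).2 == J) && ((g u).1 < I)).
  rewrite /r ltn_digits // ltn_digits //.
  have -> : (chunk u * H + (g u).2 == x %/ W) = (chunk u == T0) && ((g u).2 == J).
    apply/eqP/andP => [eq_x|[/eqP-> /eqP->]]; last by rewrite -divn_eq.
    by rewrite /T0 /J -eq_x modnMDl divnMDl // divn_small // addn0
      modn_small // !eqxx.
  by case: (_ < T0); case: (_ == T0); case: (_ < J); case: (_ == J); case: (_ < I).
clearbody T0 J I; have [nkey nkeyP] := row_key (gapN T0).
have [bkey bkP] := bkeyP I W.
pose Q := segment (a T0) (a T0.+1 + m.+1 - a T0).
have chunkQ u : chunk u = T0 -> (g u).1 \in Q.
  move=> eq_u; have nL : ~~ L T0 u by rewrite -chunk_lt eq_u ltnn.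
  have /L_le uS : L T0.+1 u by rewrite -chunk_lt eq_u.
  have au : a T0 <= (g u).1 by rewrite leqNgt; apply: contra nL; apply: L_gt.
  by rewrite in_segment au; lia.
(* The last component isolates the column [I.-1] of the row [J], the only one
   of this row that the letters relate to the rest of the row. *)
exists (fun u => if chunk u < T0 then inl (ckey T0 u)
  else inr (ckey T0.+1 u, nkey (g u).1, bkey (g u).1, (g u).2 == J,
            ((g u).2 == J) && ((g u).1.+1 == I))).
move=> u v; rewrite !r_lt.
case: (ltngtP (chunk u) T0) => //= cu;
  case: (ltngtP (chunk v) T0) => //= cv u_lt v_lt.
  move=> [eq_c] z z_ge; apply: (ckeyP (t := T0)) eq_c _ _; rewrite -?chunk_lt //.
  by apply: contra z_ge; rewrite r_lt => ->.
move=> [eq_c eq_n eq_b eq_J eq_I] z; rewrite r_lt negb_or => /andP[cz z_ge].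
have [lt_z|le_z] := ltnP T0 (chunk z).
  by apply: (ckeyP (t := T0.+1)) eq_c _ _; rewrite -chunk_lt ?cu ?cv // -leqNgt.
have cz' : chunk z = T0 by apply/eqP; rewrite eqn_leq le_z leqNgt cz.
move: z_ge u_lt v_lt eq_n eq_b eq_J eq_I (gW z)
  (chunkQ u cu) (chunkQ v cv) (chunkQ z cz').
rewrite -!g_mono cz' eqxx /=.
case: (g u) (g v) (g z) => [i p] [i' p'] [j q] /= q_ge p_lt p'_lt.
move=> eq_n eq_b eq_J eq_I jW iQ i'Q jQ.
have [/andP[pq p'q]|same_row] := boolP ((p < q) && (p' < q)).
  rewrite (P_adj_rows d i j pq (ltn0Sn 0)) (P_adj_rows d i' j p'q (ltn0Sn 0)).
  exact: nkeyP.
have [eq_p eq_p' eq_q] : [/\ p = J, p' = J & q = J] by split; lia.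
subst p p' q; move: p_lt p'_lt q_ge eq_I; rewrite !ltnn !eqxx /= => iI i'I jI.
rewrite -leqNgt in jI; case: (i.+1 =P I)
  => [eq_i /esym/eqP eq_i'|ne_i /esym/eqP ne_i'].
  by have -> : i = i' by lia.
by rewrite !P_adj_far; [apply: bkP; rewrite ?jI | lia | lia].
Qed.
End Layout.

(** * Minimality *)

Lemma hereditary_Gclass d : hereditary (Gclass d).
Proof.
move=> G H [g g_inj g_mono] [h h_inj h_mono]; exists (g \o h) => [|x y].
  exact: inj_comp.
by rewrite g_mono h_mono.
Qed.

(** The factor on the columns of an embedding of some [F] outside [D] plays the
role of the recurring factor: a stack of crossings at one of its occurrences
would put [F] into [D]. *)
Lemma proper_subclass_lcw d (D : graph_class) :
  N_bounded_recurrent d -> bounded_M (beta d) ->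
  hereditary D -> proper_subclass D (Gclass d) ->
  exists K, forall G, D G -> lcw_constructible G K.
Proof.
move=> [d_rec d_gap] /bond_key[M bkeyP] D_her [D_sub [F [e e_inj e_mono] nDF]].
pose m := (\max_x (e x).1).+1; pose n := (\max_x (e x).2).+1.
(* The extra column gives the factor length at least 2 even if [F] lies in a
   single column. *)
have em x : (e x).1 <= m by apply/leqW/(@leq_bigmax F (fun x => (e x).1)).
have en x : (e x).2 < n by rewrite ltnS (@leq_bigmax F (fun x => (e x).2)).
have [a [a0 gapP]] := occurrences d_rec (isT : 2 <= m.+1).
have [N gapN] := d_gap m.+1 0 isT.
pose Tc : finType := ('I_M.+1 + 'I_m.+1 * 'I_(n.*2).+1)%type.
exists #|(Tc + Tc * 'I_N.+1 * 'I_M.+1 * bool * bool)%type : finType|.+1 => G DG.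
have [g g_inj g_mono] := D_sub G DG.
pose W := (\max_u (g u).1).+1.
have gW u : (g u).1 < W by rewrite ltnS (@leq_bigmax G (fun u => (g u).1)).
have cut t : {Lk : pred G * (G -> Tc) | [/\ t = 0 -> forall u, ~~ Lk.1 u,
    forall u, (g u).1 < a t -> Lk.1 u, forall u, Lk.1 u -> (g u).1 <= a t + m
    & coherent (@adj G) Lk.1 Lk.2]}.
  apply: cid; have [->|t0] := eqVneq t 0.
    by exists ((fun=> false) : pred G, (fun=> inl ord0) : G -> Tc);
      split=> // u; rewrite a0.
  have [bkey bkP] := bkeyP (a t) W.
  have nostack f : ~ stack m (cell g (a t))
      (fun i => eqletter (alpha d (a t + i))) n f.
    move=> fP; apply: nDF; apply: (D_her G) => //.
    by apply: stack_induced fP => //; case: (gapP t).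
  have [L [key [L_gt L_le L_coh]]] := vertical_cut bkP gW nostack.
  exists (L, key); split=> //=; first by move/eqP; rewrite (negPf t0).
  by move=> u v Lu Lv eq_k z Lz; rewrite -!g_mono; apply: L_coh.
apply: (@layout_lcw d G g g_inj g_mono m M N Tc a bkeyP gapP _
          (fun t => (sval (cut t)).1) (fun t => (sval (cut t)).2)).
- by move=> t; apply: gapN.
- by case: (svalP (cut 0)) => /(_ erefl).
- by move=> t; case: (svalP (cut t)).
- by move=> t; case: (svalP (cut t)).
- by move=> t; case: (svalP (cut t)).
Qed.

Lemma bounded_width_minimum (P : sgraph -> nat -> Prop) (C : graph_class) K :
  (forall G, C G -> exists2 k, P G k & k <= K) ->
  bounded_width (fun G => is_minimum (P G)) C.
Proof.
move=> PK; exists K => G /PK[k Pk kK].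
have [|j [Pj j_min]] := @min_nat (P G); first by exists k.
by exists j; [split | apply: leq_trans (j_min k Pk) kK].
Qed.

Lemma lcw_cw G k : lcw_constructible G k -> cw_constructible G k.
Proof. by case=> t _ iso; exists t. Qed.

Theorem theorem4p11 (d : delta_triple) :
  in_Delta_min d ->
  minimal_unbounded has_linear_cliquewidth (Gclass d) /\
  minimal_unbounded has_cliquewidth (Gclass d).
Proof.
case=> d_unb d_N d_M; have her := @hereditary_Gclass d.
split; split=> //.
- case=> K wK; apply: d_unb.
  apply: (@bounded_width_minimum cw_constructible _ K) => G /wK[k [k_lcw _] kK].
  by exists k => //; apply: lcw_cw.
- move=> D D_her D_proper.
  have [K DK] := proper_subclass_lcw d_N d_M D_her D_proper.
  by apply: (@bounded_width_minimum lcw_constructible _ K) => G /DK; exists K.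
move=> D D_her D_proper.
have [K DK] := proper_subclass_lcw d_N d_M D_her D_proper.
apply: (@bounded_width_minimum cw_constructible _ K) => G /DK/lcw_cw.
by exists K.
Qed.
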